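(* Let $K\subset\mathbb{C}$ be compact and let $\varepsilon>0$. Put $K_\varepsilon=\{z\in\mathbb{C}: \operatorname{dist}(z,K)\le\varepsilon\}$, $K_{\varepsilon/2}=\{z\in\mathbb{C}: \operatorname{dist}(z,K)\le\varepsilon/2\}$ and $\Gamma_\varepsilon=K_\varepsilon\setminus\operatorname{int}K_{\varepsilon/2}$. Then there exists a rational function $r$ such that, with $V_r=\{z\in\mathbb{C}: |r(z)|\le 1\}$, $$K\Subset V_r\quad\text{and}\quad V_r\cap\Gamma_\varepsilon=\emptyset .$$ Further, the rational function $r=p/q$ can be chosen so that $\deg q<\deg p$.
   Context: A rational function is written $r=p/q$ with complex polynomials $p,q$ having no common roots. At a pole of $r$ one sets $|r(z)|=\infty$, so poles do not belong to $V_r$. The notation $K\Subset V$ means that $K$ is contained in the interior of $V$. *)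

(* Defs.v *)
From mathcomp Require Import all_boot all_order all_algebra.
From mathcomp Require Import all_classical all_reals all_analysis.
From mathcomp Require Export complex.
Set Implicit Arguments.
Unset Strict Implicit.
Unset Printing Implicit Defensive.

Import Order.TTheory GRing.Theory Num.Theory.
Import numFieldNormedType.Exports.
Local Open Scope classical_set_scope.
Local Open Scope ring_scope.
Local Open Scope complex_scope.

(* Sets are taken in [R[i]^o] rather than [R[i]] because the former carries the
   topology of the norm [`|z|] canonically.
   That norm is itself [R[i]]-valued; taking [complex.Re] brings it to [R]. *)
Definition cabs (R : realType) (z : R[i]) : R := complex.Re `|z|.

(* Extended-real valued, so that the distance to the empty set is [+oo]. *)
Definition dist_to (R : realType) (K : set R[i]^o) (z : R[i]^o) : \bar R :=
  ereal_inf [set (cabs (z - w))%:E | w in K].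

Definition closed_thickening (R : realType) (K : set R[i]^o) (e : R) :
    set R[i]^o :=
  [set z | (dist_to K z <= e%:E)%E].

Definition Gamma (R : realType) (K : set R[i]^o) (e : R) : set R[i]^o :=
  closed_thickening K e `\` interior (closed_thickening K (e / 2)).

Record ratfun (R : realType) := Ratfun {
  rnum : {poly R[i]};
  rden : {poly R[i]};
  rden_neq0 : rden != 0;
  no_common_root : forall z : R[i], ~ (root rnum z /\ root rden z)
}.

Definition ratfun_abs (R : realType) (r : ratfun R) (z : R[i]) : \bar R :=
  if root (rden r) z then +oo%E
  else (cabs ((rnum r).[z] / (rden r).[z]))%:E.

Definition lemniscate (R : realType) (r : ratfun R) : set R[i]^o :=
  [set z | (ratfun_abs r z <= 1)%E].

Definition compactly_inside (R : realType) (K A : set R[i]^o) : Prop :=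
  K `<=` interior A.

(* Main.v *)
Require Import Defs.
From mathcomp Require Import all_boot all_order all_algebra.
From mathcomp Require Import all_classical all_reals all_analysis.
From mathcomp Require Import ring lra zify.
(** The ratio is built from a square lattice of mesh [h], with one factor for
each point [w] of the finite set [S] of lattice points at distance at most
[e / 4] from [K]:
<<
   f(z) = \prod_(w in S) (z - w)^4 / ((z - w)^4 - h^4).
>>
Since [x^4 - h^4 = (x - h) (x + h) (x - i h) (x + i h)], the denominator of the
factor at [w] is the product of [z - w'] over the four lattice neighbours [w']
of [w].  So [log |f|] is minus the discrete Laplacian of the indicator of [S],
summed against the potential [log |z - w|]: away from [S] it is close to [0],
and well inside [S] it is close to a negative constant.

Both facts hold with explicit bounds.  If [z] is at distance at least [h m] from
a set [T] of lattice points, every factor over [T] is within a relative error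
[1 / m^4] of [1], and the number of factors is only of order [m^2], as [h m] is
a fixed multiple of [e]; the product over [T] is thus as close to [1] as desired
([far_factor], [prod_pinched]).  This settles the points of [Gamma K e].  If [z]
is near [K], then [S] contains a box of [2 m] by [2 m] lattice points centred at
[z], and the rest of [S] is far from [z].  Over the box the product telescopes
in both directions ([box_prod_ge]): [1 / |f|] becomes a product, over the sides
of the box, of the ratios of the distances from [z] to a lattice point just
outside the box and to its neighbour just inside.  All these ratios are at least
[1], and the squares of the [2 m] of them on one side are at least
[1 + 1 / (2 m)], so that the square of [1 / |f|] over the box is at least [2]
([box_prod_sqr_ge2]).

Consequently [|f| <= 16 / 21] near [K] and [|f| >= 15 / 16] on [Gamma K e]
([exists_separating_polys]).  The function [6 / 5 * f] is therefore less than
[1] near [K] and greater than [1] on [Gamma K e] in modulus, and the two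
polynomials in the fraction have the same degree; adding [eta * z] with a small
[eta > 0] keeps the inequalities and makes the numerator dominate at infinity.
Lattice points near [K] are removable singularities: the inequality there
follows by continuity after common factors are cancelled ([exists_ratfun]). *)

Set Implicit Arguments.
Unset Strict Implicit.
Unset Printing Implicit Defensive.
Import Order.TTheory GRing.Theory Num.Theory.
Import numFieldNormedType.Exports.
Local Open Scope classical_set_scope.
Local Open Scope ring_scope.
Local Open Scope complex_scope.

(** * The modulus of a complex number *)

Section Modulus.
Variable R : realType.
Implicit Types z w : R[i].

Lemma cabs_normc z : cabs z = ComplexField.Normc.normc z.
Proof. by rewrite /cabs normc_def; case: z. Qed.

Lemma normr_cabs z : `|z| = (cabs z)%:C.
Proof. by rewrite /cabs normc_def. Qed.

Lemma cabs_ge0 z : 0 <= cabs z.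
Proof. by rewrite /cabs normc_def sqrtr_ge0. Qed.

Lemma cabs_sqr z : cabs z ^+ 2 = complex.Re z ^+ 2 + complex.Im z ^+ 2.
Proof. by rewrite /cabs normc_def sqr_sqrtr// addr_ge0// sqr_ge0. Qed.

Lemma cabs0 : cabs (0 : R[i]) = 0. Proof. by rewrite /cabs normr0. Qed.
Lemma cabs1 : cabs (1 : R[i]) = 1. Proof. by rewrite /cabs normr1. Qed.
Lemma cabsN z : cabs (- z) = cabs z. Proof. by rewrite /cabs normrN. Qed.
Lemma cabs_distC z w : cabs (z - w) = cabs (w - z).
Proof. by rewrite /cabs distrC. Qed.

Lemma cabsM z w : cabs (z * w) = cabs z * cabs w.
Proof. by rewrite !cabs_normc ComplexField.Normc.normcM. Qed.

Lemma cabsX z n : cabs (z ^+ n) = cabs z ^+ n.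
Proof. by elim: n => [|n IH]; rewrite ?cabs1 // !exprS cabsM IH. Qed.

Lemma cabsV z : cabs z^-1 = (cabs z)^-1.
Proof. by rewrite !cabs_normc ComplexField.Normc.normcV. Qed.

Lemma cabs_prod I (s : seq I) (P : pred I) (F : I -> R[i]) :
  cabs (\prod_(i <- s | P i) F i) = \prod_(i <- s | P i) cabs (F i).
Proof. exact: (big_morph _ cabsM cabs1). Qed.

Lemma cabsD z w : cabs (z + w) <= cabs z + cabs w.
Proof. by rewrite -lecR rmorphD/= -!normr_cabs ler_normD. Qed.

Lemma cabs_triangle u z w : cabs (z - w) <= cabs (z - u) + cabs (u - w).
Proof. by rewrite -(subrKA u z (- w)) cabsD. Qed.

Lemma cabs_dist_sub z w : cabs z - cabs w <= cabs (z - w).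
Proof. by rewrite lerBlDr -{1}(subrK w z) cabsD. Qed.

Lemma cabs_eq0 z : (cabs z == 0) = (z == 0).
Proof.
apply/eqP/eqP => [|->]; last exact: cabs0.
by rewrite cabs_normc; exact: ComplexField.Normc.eq0_normc.
Qed.

Lemma cabs_gt0 z : (0 < cabs z) = (z != 0).
Proof. by rewrite lt_def cabs_ge0 andbT cabs_eq0. Qed.

Lemma cabs_real (x : R) : cabs x%:C = `|x|.
Proof. by rewrite cabs_normc /= expr0n addr0 sqrtr_sqr. Qed.

Lemma normr_Re_le_cabs z : `|complex.Re z| <= cabs z.
Proof.
rewrite -(ger0_norm (cabs_ge0 z)) -ler_sqr ?nnegrE//.
by rewrite !real_normK ?num_real// cabs_sqr lerDl sqr_ge0.
Qed.

Lemma normr_Im_le_cabs z : `|complex.Im z| <= cabs z.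
Proof.
rewrite -(ger0_norm (cabs_ge0 z)) -ler_sqr ?nnegrE//.
by rewrite !real_normK ?num_real// cabs_sqr lerDr sqr_ge0.
Qed.

Lemma cabs_le_Re_Im z : cabs z <= `|complex.Re z| + `|complex.Im z|.
Proof.
rewrite -ler_sqr ?nnegrE ?cabs_ge0 ?addr_ge0// cabs_sqr sqrrD.
rewrite !real_normK ?num_real// -addrA lerD2l lerDr.
by rewrite mulrn_wge0// mulr_ge0.
Qed.

Lemma nbhs_cabsP (z : R[i]^o) (A : set R[i]^o) :
  nbhs z A <-> exists2 d : R, 0 < d & forall w, cabs (z - w) < d -> A w.
Proof.
split=> [/nbhs_ballP[d/= d0 dA]|[d d0 dA]].
  have dE : d = (complex.Re d)%:C by rewrite RRe_real// realE ltW.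
  exists (complex.Re d) => [|w zw]; first by rewrite -ltcR -dE.
  by apply: dA; rewrite -ball_normE /= normr_cabs dE ltcR.
apply/nbhs_ballP; exists d%:C => /=; first by rewrite ltcR.
by move=> w; rewrite -ball_normE /= normr_cabs ltcR; exact: dA.
Qed.

Lemma cabs_continuous : continuous (@cabs R : R[i]^o -> R^o).
Proof.
move=> z A /nbhs_ballP[e e0 eA]; apply/nbhs_cabsP; exists e => // w zw.
apply: eA; rewrite -ball_normE /=; apply: le_lt_trans zw; rewrite ler_norml cabs_dist_sub andbT.
by rewrite cabs_distC lerNl opprB cabs_dist_sub.
Qed.

Lemma horner_complex_continuous (p : {poly R[i]}) :
  continuous (fun z : R[i]^o => p.[z] : R[i]^o).
Proof.
elim/poly_ind: p => [|p c IH] z.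
  have -> : (fun w : R[i]^o => (0 : {poly R[i]}).[w] : R[i]^o) = cst 0.
    by apply/funext => w; rewrite horner0.
  exact: cst_continuous.
have -> : (fun w : R[i]^o => (p * 'X + c%:P).[w] : R[i]^o)
        = (fun w : R[i]^o => (p.[w] : R[i]^o) * w + (c : R[i]^o)).
  by apply/funext => w; rewrite hornerMXaddC.
have cM : {for z, continuous (fun w : R[i]^o => (p.[w] : R[i]^o) * w)}.
  by apply: continuousM; [exact: IH|by move=> A].
by apply: (continuousD cM); exact: cst_continuous.
Qed.

Lemma compact_cabs_bounded (K : set R[i]^o) : compact K ->
  exists B : R, forall k, K k -> cabs k <= B.
Proof.
move=> cK.
have cc : {within K, continuous (@cabs R : R[i]^o -> R^o)}.
  by apply: continuous_subspaceT; exact: cabs_continuous.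
have /compact_bounded[M [_ MK]] := continuous_compact cc cK.
exists (M + 1) => k Kk; apply: le_trans (ler_norm _) _.
by apply: (MK (M + 1)); [rewrite ltrDl|exists k].
Qed.

(** A disc is infinite, so a nonzero polynomial cannot vanish on all of it. *)
Lemma exists_nonroot_near (D : {poly R[i]}) z (d : R) : D != 0 -> 0 < d ->
  exists2 w, cabs (z - w) < d & ~~ root D w.
Proof.
move=> D0 d0; apply: contrapT => H.
have HD w : cabs (z - w) < d -> root D w.
  by move=> zw; apply/negPn/negP => Dw; apply: H; exists w.
(* The shift by two keeps the points strictly inside the disc, [k = 0] included. *)
pose f (k : nat) := z + (d / k.+2%:R)%:C.
have f_inj : injective f.
  move=> j k /addrI [] /(mulfI (lt0r_neq0 d0)) /invr_inj /eqP.
  by rewrite eqr_nat => /eqP[].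
pose rs := [seq f k | k <- iota 0 (size D)].
have rs_uniq : uniq rs by rewrite map_inj_uniq// iota_uniq.
suff rs_root : all (root D) rs.
  by have := max_poly_roots D0 rs_root rs_uniq; rewrite size_map size_iota ltnn.
apply/allP => _ /mapP[k _ ->]; apply: HD.
rewrite /f opprD addNKr cabsN cabs_real ger0_norm ?divr_ge0 ?ltW//.
by rewrite ltr_pdivrMr ?ltr0n// ltr_pMr// ltr1n.
Qed.

(** A nonstrict inequality between moduli of polynomials passes to the finitely
many omitted points by continuity. *)
Lemma cabs_horner_le_extend (p q D : {poly R[i]}) z (d : R) : D != 0 -> 0 < d ->
  (forall w, cabs (z - w) < d -> ~~ root D w -> cabs p.[w] <= cabs q.[w]) ->
  cabs p.[z] <= cabs q.[z].
Proof.
move=> D0 d0 H; rewrite leNgt; apply/negP => qp.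
have c (f : {poly R[i]}) : (fun w : R[i]^o => cabs f.[w] : R^o) @ (z : R[i]^o)
    --> (cabs f.[z] : R^o).
  exact: (@continuous_comp (R[i]^o) (R[i]^o) (R^o) (fun w => f.[w]) (@cabs R) z
    (@horner_complex_continuous f z) (@cabs_continuous f.[z])).
have e0 : 0 < (cabs p.[z] - cabs q.[z]) / 2 by rewrite divr_gt0// subr_gt0.
have /cvgrPdist_lt/(_ _ e0)/nbhs_cabsP[d1 d10 Hp] := c p.
have /cvgrPdist_lt/(_ _ e0)/nbhs_cabsP[d2 d20 Hq] := c q.
have m0 : 0 < Num.min d (Num.min d1 d2) by rewrite !lt_min d0 d10 d20.
have [w] := exists_nonroot_near z D0 m0.
rewrite !lt_min => /and3P[zd zd1 zd2] Dw.
have := H w zd Dw; have := Hp w zd1; have := Hq w zd2 => /=.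
rewrite !ltr_norml => /andP[h1 h2] /andP[h3 h4].
by lra.
Qed.

End Modulus.

(** * Rational functions in lowest terms *)

Section Reduction.
Variable R : realType.
Implicit Types (z w : R[i]) (p q : {poly R[i]}) (r : ratfun R).

(** At a pole the numerator does not vanish, so the inequality between the two
moduli fails there as well: it needs no separate clause for poles. *)
Lemma lemniscateE r z :
  lemniscate r z <-> cabs (rnum r).[z] <= cabs (rden r).[z].
Proof.
rewrite /lemniscate /= /ratfun_abs; case: ifPn => [qz|qz].
  rewrite (rootP qz) cabs0; split => // pz.
  case: (no_common_root (z := z) (conj _ qz)).
  by rewrite /root -cabs_eq0 eq_le pz cabs_ge0.
by rewrite lee_fin cabsM cabsV ler_pdivrMr ?mul1r // cabs_gt0.
Qed.

Lemma exists_reduced_ratfun p q : q != 0 ->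
  exists r g, [/\ g != 0, p = g * rnum r & q = g * rden r].
Proof.
move=> q0; pose g := gcdp p q.
have g0 : g != 0 by rewrite gcdp_eq0 negb_and q0 orbT.
have pE : p = g * (p %/ g) by rewrite mulrC divpK// dvdp_gcdl.
have qE : q = g * (q %/ g) by rewrite mulrC divpK// dvdp_gcdr.
have q'0 : q %/ g != 0 by apply: contra_neq q0 => q'0; rewrite qE q'0 mulr0.
have cop z : ~ (root (p %/ g) z /\ root (q %/ g) z).
  move=> [pz qz]; have /coprimep_root : coprimep (p %/ g) (q %/ g).
    by rewrite coprimep_div_gcd// q0 orbT.
  by move=> /(_ _ pz); rewrite (rootP qz) eqxx.
by exists (Ratfun q'0 cop), g.
Qed.

(** Cancelling common factors changes neither strict inequalities nor, by
continuity, the nonstrict inequalities that hold off a finite set; this is what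
makes poles of the unreduced fraction harmless inside the lemniscate. *)
Lemma exists_ratfun p q : q != 0 -> (size q < size p)%N ->
  exists r,
    [/\ (size (rden r) < size (rnum r))%N,
        forall z, cabs q.[z] < cabs p.[z] -> ~ lemniscate r z
      & forall (D : {poly R[i]}) z (d : R), D != 0 -> 0 < d ->
        (forall w, cabs (z - w) < d -> ~~ root D w ->
           cabs p.[w] <= cabs q.[w]) ->
        lemniscate r z].
Proof.
move=> q0 qp; have [r [g [g0 pE qE]]] := exists_reduced_ratfun p q0.
exists r; split.
- have n0 : rnum r != 0.
    by apply: contraTneq qp => n0; rewrite pE n0 mulr0 size_poly0.
  move: qp; rewrite pE qE !size_mul ?rden_neq0//.
  have: (0 < size g)%N by rewrite size_poly_gt0.
  by case: (size g) => // n _; rewrite !addSn ltn_add2l.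
- move=> z; rewrite pE qE !hornerM !cabsM => qpz /lemniscateE.
  by move=> /(ler_wpM2l (cabs_ge0 g.[z])); rewrite leNgt qpz.
- move=> D z d D0 d0 H; apply/lemniscateE.
  apply: (@cabs_horner_le_extend _ _ _ (D * g) z d) => //.
    by rewrite mulf_neq0.
  move=> w zw; rewrite rootM negb_or => /andP[Dw gw].
  have := H w zw Dw; rewrite pE qE !hornerM !cabsM ler_pM2l//.
  by rewrite cabs_gt0.
Qed.

End Reduction.

(** * Telescoping products over a box *)

Section GridProducts.
Variable R : realType.

(** The exponential form of the summation of second differences. *)
Lemma prod_second_ratio (N : nat -> R) (l s : nat) : (0 < s)%N ->
  (forall i, (l <= i <= (l + s).+1)%N -> 0 < N i) ->
  \prod_(l.+1 <= i < (l + s).+1) (N i.+1 * N i.-1 / N i ^+ 2) =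
  (N (l + s).+1 / N (l + s)%N) * (N l / N l.+1).
Proof.
move=> s0 N0; rewrite (telescope_prodf_eq (fun i => N i / N i.-1)) /=.
- by rewrite invf_div.
- move=> k /andP[k1 k2]; rewrite mulf_neq0 ?invr_eq0// gt_eqF// N0//; lia.
- by rewrite ltnS -addn1 leq_add2l.
- move=> k /andP[k1 k2]; rewrite invf_div.
  have : N k != 0 by rewrite gt_eqF// N0//; lia.
  have : N k.-1 != 0 by rewrite gt_eqF// N0//; lia.
  by move=> ? ?; field.
Qed.

(** Telescoping leaves one ratio per point of the boundary, between a point just
outside the box and its neighbour just inside; hence the hypotheses on the four
sides suffice. *)
Lemma box_prod_ge (N : nat -> nat -> R) (l k s : nat) (rho : R) : (0 < s)%N ->
  0 <= rho ->
  (forall i j, (l <= i <= (l + s).+1)%N -> (k <= j <= (k + s).+1)%N ->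
     0 < N i j) ->
  (forall j, (k < j <= k + s)%N -> N l.+1 j <= N l j) ->
  (forall j, (k < j <= k + s)%N -> rho * N (l + s)%N j <= N (l + s).+1 j) ->
  (forall i, (l < i <= l + s)%N -> N i k.+1 <= N i k) ->
  (forall i, (l < i <= l + s)%N -> N i (k + s)%N <= N i (k + s).+1) ->
  rho ^+ s <= \prod_(l.+1 <= i < (l + s).+1) \prod_(k.+1 <= j < (k + s).+1)
    (N i.+1 j * N i.-1 j * N i j.+1 * N i j.-1 / N i j ^+ 4).
Proof.
move=> s0 rho0 N0 Hl Hr Hb Ht.
(* Each factor splits into a horizontal and a vertical second ratio. *)
have -> : \prod_(l.+1 <= i < (l + s).+1) \prod_(k.+1 <= j < (k + s).+1)
    (N i.+1 j * N i.-1 j * N i j.+1 * N i j.-1 / N i j ^+ 4) =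
  (\prod_(k.+1 <= j < (k + s).+1)
     ((N (l + s).+1 j / N (l + s)%N j) * (N l j / N l.+1 j))) *
  \prod_(l.+1 <= i < (l + s).+1)
     ((N i (k + s).+1 / N i (k + s)%N) * (N i k / N i k.+1)).
  transitivity (\prod_(l.+1 <= i < (l + s).+1) \prod_(k.+1 <= j < (k + s).+1)
      (N i.+1 j * N i.-1 j / N i j ^+ 2 * (N i j.+1 * N i j.-1 / N i j ^+ 2))).
    apply: eq_big_nat => i Hi; apply: eq_big_nat => j Hj.
    have ? : N i j != 0 by rewrite gt_eqF// N0//; lia.
    by field.
  under eq_big_nat => i Hi do rewrite big_split /=.
  rewrite big_split /= exchange_big /=; congr (_ * _).
    apply: eq_big_nat => j Hj; apply: (prod_second_ratio (N := N ^~ j)) => //.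
    by move=> i Hi; apply: N0 => //; lia.
  apply: eq_big_nat => i Hi; apply: (prod_second_ratio (N := N i)) => //.
  by move=> j Hj; apply: N0 => //; lia.
(* Only the right side of the box is used quantitatively. *)
have -> : rho ^+ s = (\prod_(k.+1 <= j < (k + s).+1) rho) * 1.
  by rewrite big_const_nat iter_mulr_1 mulr1; congr (_ ^+ _); lia.
apply: ler_pM => //.
- by apply: prodr_ge0.
- rewrite !big_nat; apply: ler_prod => j Hj; rewrite rho0 /=.
  rewrite -[leLHS]mulr1; apply: ler_pM => //.
    by rewrite ler_pdivlMr ?Hr ?N0//; lia.
  by rewrite ler_pdivlMr ?mul1r ?Hl ?N0//; lia.
- rewrite big_nat; apply: (big_ind (fun x : R => 1 <= x)) => // [x y|i Hi].
    exact: mulr_ege1.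
  by rewrite mulr_ege1// ler_pdivlMr ?mul1r ?Hb ?Ht ?N0//; lia.
Qed.

Lemma bernoulli_le (x : R) (n : nat) : -1 <= x -> 1 + n%:R * x <= (1 + x) ^+ n.
Proof.
move=> x1; elim: n => [|n IH]; first by rewrite mul0r addr0 expr0.
have x10 : 0 <= 1 + x by rewrite -lerBlDl sub0r.
rewrite exprS; apply: le_trans (ler_wpM2l x10 IH).
rewrite -subr_ge0 -natr1.
have -> : (1 + x) * (1 + n%:R * x) - (1 + (n%:R + 1) * x) = n%:R * x ^+ 2 by ring.
by rewrite mulr_ge0// sqr_ge0.
Qed.

(** Factors that deviate from each other by a relative error [x] have products
that deviate by at most the accumulated error [y]. *)
Lemma prod_pinched (I : finType) (T : {pred I}) (a b : I -> R) (x y : R) :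
  x <= 1 -> #|T|%:R * x <= y ->
  (forall p, p \in T -> 0 <= a p) ->
  (forall p, p \in T -> (1 - x) * a p <= b p) ->
  (1 - y) * \prod_(p in T) a p <= \prod_(p in T) b p.
Proof.
move=> x1 Txy a0 ab.
have : (1 - x) ^+ #|T| * \prod_(p in T) a p <= \prod_(p in T) b p.
  rewrite -prodr_const -big_split /=; apply: ler_prod => p pT.
  by rewrite ab// andbT mulr_ge0 ?a0// subr_ge0.
apply: le_trans; apply: ler_wpM2r; first exact: prodr_ge0.
apply: le_trans (bernoulli_le _ _); last by rewrite lerN2.
by rewrite mulrN lerD2l lerN2.
Qed.

Lemma prod_box_ord (L l k s t : nat) (F : nat -> nat -> R) :
  (l + s < L)%N -> (k + t < L)%N ->
  \prod_(p : 'I_L * 'I_L | (l < p.1 <= l + s)%N && (k < p.2 <= k + t)%N)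
    F p.1 p.2 =
  \prod_(l.+1 <= i < (l + s).+1) \prod_(k.+1 <= j < (k + t).+1) F i j.
Proof.
move=> lL kL.
rewrite -(pair_big (fun i : 'I_L => l < i <= l + s)%N
  (fun j : 'I_L => k < j <= k + t)%N (fun i j : 'I_L => F i j)) /=.
rewrite (big_nat_widen _ _ L)// big_geq_mkord.
apply: eq_big => [i|i _]; first by rewrite /= ltnS andbC.
rewrite (big_nat_widen _ _ L)// big_geq_mkord.
by apply: eq_big => [j|//]; rewrite /= ltnS andbC.
Qed.

End GridProducts.

(** * The lattice near a point *)

Section Lattice.
Variables (R : realType) (c : R[i]) (h : R).
Hypothesis h0 : 0 < h.

Definition node (i j : nat) : R[i] := c + (h * i%:R +i* (h * j%:R)).

(** The four roots of [x^4 = h^4] are [h], [- h], [i h] and [- i h], the steps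
from a lattice point to its neighbours. *)
Lemma quartic_node z i j : (0 < i)%N -> (0 < j)%N ->
  (z - node i j) ^+ 4 - (h ^+ 4)%:C =
  (z - node i.+1 j) * (z - node i.-1 j) * (z - node i j.+1) * (z - node i j.-1).
Proof.
case: i j => [//|i] [//|j] _ _ /=.
have iS k : node k.+1 j.+1 = node k j.+1 + h%:C.
  by rewrite /node -addrA; congr (_ + _); apply/eqP; rewrite eq_complex /=;
    apply/andP; split; apply/eqP; rewrite -?natr1; ring.
have jS k : node i.+1 k.+1 = node i.+1 k + h%:C * 'i.
  by rewrite /node -addrA; congr (_ + _); apply/eqP; rewrite eq_complex /=;
    apply/andP; split; apply/eqP; rewrite -?natr1; ring.
have iN : node i j.+1 = node i.+1 j.+1 - h%:C by rewrite iS addrK.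
have jN : node i.+1 j = node i.+1 j.+1 - h%:C * 'i by rewrite jS addrK.
rewrite iN jN (iS i.+1) (jS j.+1).
have i2 : 'i ^+ 2 = -1 :> R[i] by rewrite sqr_i.
rewrite rmorphXn /=.
set u := node _ _; set H := h%:C.
transitivity (((z - u) ^+ 2 - H ^+ 2) * ((z - u) ^+ 2 - H ^+ 2 * 'i ^+ 2)).
  by rewrite i2; ring.
by ring.
Qed.

Lemma Re_sub_node z i j :
  complex.Re (z - node i j) = complex.Re (z - c) - h * i%:R.
Proof. by rewrite /node opprD addrA; case: (z - c). Qed.

Lemma Im_sub_node z i j :
  complex.Im (z - node i j) = complex.Im (z - c) - h * j%:R.
Proof. by rewrite /node opprD addrA; case: (z - c). Qed.

Lemma cabs_node_sqr z i j : cabs (z - node i j) ^+ 2 =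
  (complex.Re (z - c) - h * i%:R) ^+ 2 + (complex.Im (z - c) - h * j%:R) ^+ 2.
Proof. by rewrite cabs_sqr Re_sub_node Im_sub_node. Qed.

(** The box consists of the [2 m] columns [a - m + 1, ..., a + m] and of the
[2 m] rows [b - m + 1, ..., b + m], where [(a, b)] is the corner of the lattice
cell of [z]; so [z] is at horizontal and vertical distance between [(m - 1) h]
and [m h] from the outermost points of the box.  Squared distances [N] are used
because the ratios on the right side then have the rational lower bound
[1 + 1 / (2 m)], whose [2 m]-th power is at least [2] by Bernoulli's inequality. *)
Lemma box_prod_sqr_ge2 z (a b m : nat) :
  (0 < m)%N -> (m <= a)%N -> (m <= b)%N ->
  h * a%:R <= complex.Re (z - c) < h * a.+1%:R ->
  h * b%:R <= complex.Im (z - c) < h * b.+1%:R ->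
  (forall i j, (i <= (a + m).+1)%N -> (j <= (b + m).+1)%N -> z != node i j) ->
  2 <= (\prod_((a - m).+1 <= i < (a - m + 2 * m).+1)
        \prod_((b - m).+1 <= j < (b - m + 2 * m).+1)
         (cabs ((z - node i j) ^+ 4 - (h ^+ 4)%:C) / cabs ((z - node i j) ^+ 4)))
       ^+ 2.
Proof.
move=> m0 ma mb /andP[Xa Xa1] /andP[Yb Yb1] z_node.
set X := complex.Re (z - c) in Xa Xa1; set Y := complex.Im (z - c) in Yb Yb1.
pose N i j := cabs (z - node i j) ^+ 2.
have NE i j : N i j = (X - h * i%:R) ^+ 2 + (Y - h * j%:R) ^+ 2.
  by rewrite /N cabs_node_sqr.
have N0 i j : (i <= (a + m).+1)%N -> (j <= (b + m).+1)%N -> 0 < N i j.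
  by move=> ia jb; rewrite exprn_gt0// cabs_gt0 subr_eq0 z_node.
have m1 : 1 <= m%:R :> R by rewrite ler1n.
have m20 : (0 < 2 * m)%N by lia.
have rho0 : 0 <= 1 + (2 * m)%:R^-1 :> R by rewrite addr_ge0.
rewrite -prodrXl.
under eq_bigr => i _ do rewrite -prodrXl.
have e2 : 2 <= (1 + (2 * m)%:R^-1 : R) ^+ (2 * m).
  have x1 : -1 <= (2 * m)%:R^-1 :> R by rewrite (le_trans (lerN10 _)).
  by apply: le_trans (bernoulli_le _ x1); rewrite mulfV// pnatr_eq0; lia.
apply: (le_trans e2).
have am : (a - m)%:R = a%:R - m%:R :> R by rewrite natrB.
have bm : (b - m)%:R = b%:R - m%:R :> R by rewrite natrB.
have -> : \prod_((a - m).+1 <= i < (a - m + 2 * m).+1)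
        \prod_((b - m).+1 <= j < (b - m + 2 * m).+1)
   (cabs ((z - node i j) ^+ 4 - (h ^+ 4)%:C) / cabs ((z - node i j) ^+ 4)) ^+ 2
  = \prod_((a - m).+1 <= i < (a - m + 2 * m).+1)
      \prod_((b - m).+1 <= j < (b - m + 2 * m).+1)
    (N i.+1 j * N i.-1 j * N i j.+1 * N i j.-1 / N i j ^+ 4).
  apply: eq_big_nat => i Hi; apply: eq_big_nat => j Hj.
  rewrite quartic_node; [|lia|lia].
  rewrite cabsX !cabsM expr_div_n /N; congr (_ / _).
    by rewrite !exprMn.
  by rewrite -!exprM mulnC.
apply: box_prod_ge => //.
- by move=> i j Hi Hj; apply: N0; lia.
- move=> j Hj; rewrite !NE lerD2r -natr1 am.
  have : h <= h * m%:R by rewrite ler_peMr// ltW.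
  by move=> hm; nra.
- move=> j Hj; rewrite !NE.
  have -> : (a - m + 2 * m).+1%:R = a%:R + m%:R + 1 :> R.
    by rewrite -natr1 -natrD; congr (_%:R + _); lia.
  have -> : (a - m + 2 * m)%:R = a%:R + m%:R :> R.
    by rewrite -natrD; congr (_%:R); lia.
  rewrite mulrDl mul1r -lerBrDl ler_pdivrMl ?ltr0n//.
  have jl : b%:R - m%:R + 1 <= j%:R :> R.
    by rewrite -bm natr1 ler_nat; lia.
  have jr : j%:R <= b%:R + m%:R :> R by rewrite -natrD ler_nat; lia.
  have hjl : h * (b%:R - m%:R + 1) <= h * j%:R by rewrite ler_wpM2l// ltW.
  have hjr : h * j%:R <= h * (b%:R + m%:R) by rewrite ler_wpM2l// ltW.
  (* In terms of the offsets [x] and [y] from [z] to a point of the right side,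
     the claim is [x^2 + y^2 <= 2 m (2 x h + h^2)]; the left side is at most
     [2 (m h)^2] and the right side at least [2 m (2 m - 1) h^2]. *)
  set x := h * (a%:R + m%:R) - X.
  set y := Y - h * j%:R.
  have hm : h <= h * m%:R by rewrite ler_peMr// ltW.
  rewrite -!natr1 in Xa1 Yb1.
  have x1 : h * m%:R - h <= x by rewrite /x; lra.
  have x2 : x <= h * m%:R by rewrite /x; lra.
  have y1 : - (h * m%:R) <= y by rewrite /y; lra.
  have y2 : y <= h * m%:R by rewrite /y; lra.
  have xx : x ^+ 2 <= (h * m%:R) ^+ 2 by nra.
  have yy : y ^+ 2 <= (h * m%:R) ^+ 2 by nra.
  have -> : (X - h * (a%:R + m%:R)) ^+ 2 = x ^+ 2 by rewrite /x; ring.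
  have -> : (X - h * (a%:R + m%:R + 1)) ^+ 2 = (x + h) ^+ 2 by rewrite /x; ring.
  have -> : (x + h) ^+ 2 + y ^+ 2 - (x ^+ 2 + y ^+ 2) = h * (2 * x + h) by ring.
  apply: (@le_trans _ _ (2 * (h * m%:R) ^+ 2)); first by lra.
  have -> : 2 * (h * m%:R) ^+ 2 = (2 * m)%:R * (h * (h * m%:R)).
    by rewrite natrM; ring.
  rewrite ler_wpM2l// ler_wpM2l ?(ltW h0)//; lra.
- move=> j Hj; rewrite !NE lerD2l -natr1 bm.
  have : h <= h * m%:R by rewrite ler_peMr// ltW.
  by move=> hm; nra.
- move=> i Hi; rewrite !NE lerD2l.
  have -> : (b - m + 2 * m).+1%:R = b%:R + m%:R + 1 :> R.
    by rewrite -natr1 -natrD; congr (_%:R + _); lia.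
  have -> : (b - m + 2 * m)%:R = b%:R + m%:R :> R.
    by rewrite -natrD; congr (_%:R); lia.
  have hm : h <= h * m%:R by rewrite ler_peMr// ltW.
  rewrite -natr1 in Yb1.
  nra.
Qed.

Lemma far_factor (w : R[i]) (m : nat) : (0 < m)%N -> h * m%:R <= cabs w ->
  (1 - (m%:R ^+ 4)^-1) * cabs (w ^+ 4) <= cabs (w ^+ 4 - (h ^+ 4)%:C) /\
  (1 - (m%:R ^+ 4)^-1) * cabs (w ^+ 4 - (h ^+ 4)%:C) <= cabs (w ^+ 4).
Proof.
move=> m0 hw.
set x := (m%:R ^+ 4)^-1; set U := cabs (w ^+ 4); set V := cabs _.
have mp : 0 < m%:R ^+ 4 :> R by rewrite exprn_gt0// ltr0n.
have x0 : 0 <= x by rewrite invr_ge0 ltW.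
have x1 : x <= 1 by rewrite invf_le1// exprn_ege1// ler1n.
have U0 : 0 <= U by exact: cabs_ge0.
have hU : h ^+ 4 <= x * U.
  rewrite /x /U cabsX mulrC ler_pdivlMr// -exprMn.
  by rewrite lerXn2r// nnegrE ?mulr_ge0 ?cabs_ge0// ltW.
have hc : cabs ((h ^+ 4)%:C) = h ^+ 4.
  by rewrite cabs_real ger0_norm// exprn_ge0// ltW.
have V1 : U - h ^+ 4 <= V by rewrite -hc cabs_dist_sub.
have V2 : V <= U + h ^+ 4 by rewrite -hc -(cabsN (h ^+ 4)%:C) cabsD.
by split; nra.
Qed.

End Lattice.

Lemma subn_add_double (m a : nat) : (m <= a)%N -> (a - m + 2 * m = a + m)%N.
Proof. by move=> ma; rewrite mul2n -addnn addnA subnK. Qed.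

(** * The quotient attached to a neighbourhood of K *)

Section LatticeRatio.
Variables (R : realType) (K : set R[i]^o) (e : R) (A : nat).
Hypothesis e0 : 0 < e.
Hypothesis KA : forall k, K k -> cabs k <= A%:R * e.

(* The constants are chosen so that [h m = e / 16], the distance that counts as
far; so that the lattice square with corner [c] and side [L h = 2 (A + 1) e]
contains the disc of radius [(A + 1) e] about the origin, hence all points near
[K]; and so that [L = m^2 / 4], which makes [L^2] factors with relative error
[1 / m^4] deviate from [1] by at most [1 / 16] in total. *)
Let m := (128 * A.+1)%N.
Let L := (32 * A.+1 * m)%N.
Let h : R := e / (16 * m%:R).
Let c : R[i] := - (A.+1%:R * e) +i* - (A.+1%:R * e).
Let nd (p : 'I_L * 'I_L) : R[i] := node c h p.1 p.2.
Let S : {set 'I_L * 'I_L} :=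
  [set p | `[< exists2 k, K k & cabs (nd p - k) <= e / 4 >]].
Let U (z : R[i]) p := cabs ((z - nd p) ^+ 4).
Let V (z : R[i]) p := cabs ((z - nd p) ^+ 4 - (h ^+ 4)%:C).

Let m_gt0 : (0 < m)%N. Proof. by rewrite /m; lia. Qed.

Let h_gt0 : 0 < h.
Proof. by rewrite divr_gt0// mulr_gt0// ltr0n. Qed.

Let hmE : h * m%:R = e / 16.
Proof. by rewrite /h; field; rewrite pnatr_eq0; lia. Qed.

Let far_prods (z : R[i]) (T : {pred 'I_L * 'I_L}) :
  (forall p, p \in T -> e / 16 <= cabs (z - nd p)) ->
  15 / 16 * \prod_(p in T) U z p <= \prod_(p in T) V z p /\
  15 / 16 * \prod_(p in T) V z p <= \prod_(p in T) U z p.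
Proof.
move=> HT.
have x1 : (m%:R ^+ 4)^-1 <= 1 :> R.
  by rewrite invf_le1 ?exprn_gt0 ?ltr0n// exprn_ege1// ler1n.
have Tx : #|T|%:R * (m%:R ^+ 4)^-1 <= 1 / 16 :> R.
  have TL : (#|T| <= L * L)%N.
    by apply: leq_trans (max_card _) _; rewrite card_prod card_ord.
  rewrite ler_pdivrMr ?exprn_gt0 ?ltr0n//.
  apply: (@le_trans _ _ (L * L)%:R); first by rewrite ler_nat.
  rewrite /L /m !natrM; set a := A.+1%:R.
  by lra.
have e16 : 15 / 16 = 1 - 1 / 16 :> R by field.
rewrite e16; split; apply: (prod_pinched x1 Tx) => p pT; try exact: cabs_ge0.
  have := HT p pT; rewrite -hmE => /(far_factor h_gt0 m_gt0) [] //.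
by have := HT p pT; rewrite -hmE => /(far_factor h_gt0 m_gt0) [].
Qed.

(** Points of [S] are within [e / 4] of [K], hence at distance at least [e / 4]
from a point whose distance to [K] is at least [e / 2]. *)
Lemma lattice_ratio_far (z : R[i]) :
  (forall k, K k -> e / 2 <= cabs (z - k)) ->
  15 / 16 * \prod_(p in S) V z p <= \prod_(p in S) U z p /\
  0 < \prod_(p in S) U z p.
Proof.
move=> zK.
have HS p : p \in S -> e / 4 <= cabs (z - nd p).
  rewrite inE => /asboolP[k Kk pk].
  have := le_trans (zK k Kk) (cabs_triangle (nd p) z k).
  by move=> /le_trans/(_ (lerD (lexx _) pk)); lra.
have e164 : e / 16 <= e / 4 by move: e0; lra.
have e40 : 0 < e / 4 by move: e0; lra.
split; first by apply: (far_prods _).2 => p /HS; exact: le_trans.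
apply: prodr_gt0 => p /HS zp; rewrite /U cabsX exprn_gt0//.
exact: lt_le_trans zp.
Qed.

(** The box around [z] has points within [e / 8] of [z], so it lies in [S] and
contributes a factor at least [sqrt 2 > 7 / 5]; the rest of [S] is far from [z]
and contributes at least [15 / 16].  Their product is [21 / 16]. *)
Lemma lattice_ratio_near (z k : R[i]) : K k -> cabs (k - z) < e / 8 ->
  (forall i j, (i <= L)%N -> (j <= L)%N -> z != node c h i j) ->
  21 / 16 * \prod_(p in S) U z p <= \prod_(p in S) V z p.
Proof.
move=> Kk kz z_node.
have zA : cabs z <= A%:R * e + e / 8.
  have := KA Kk; have := cabs_dist_sub z k.
  by move: kz; rewrite cabs_distC; lra.
have coord (x : R) : `|x| <= cabs z ->
    exists a : nat, [/\ (m <= a)%N, (a + m < L)%N,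
      h * a%:R <= x + A.+1%:R * e & x + A.+1%:R * e < h * a%:R + h].
  move=> xz; have := le_trans xz zA; rewrite ler_norml => /andP[x1 x2].
  have X0 : 14 * (h * m%:R) <= x + A.+1%:R * e.
    by rewrite hmE -natr1; lra.
  have X1 : x + A.+1%:R * e <= h * ((32 * A + 18) * m)%:R.
    rewrite natrM mulrCA hmE natrD natrM -natr1; lra.
  have hm0 : 0 <= 14 * (h * m%:R) by rewrite !mulr_ge0// ltW.
  have /truncn_itv/andP[] : 0 <= (x + A.+1%:R * e) / h.
    by rewrite divr_ge0 ?(ltW h_gt0)//; exact: le_trans X0.
  set a := Num.truncn _ => a1 a2; exists a.
  rewrite ler_pdivlMr// [_ * h]mulrC in a1.
  rewrite ltr_pdivrMr// [_ * h]mulrC in a2.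
  have ma : (14 * m < a.+1)%N.
    rewrite -(ltr_nat R) natrM -(ltr_pM2l h_gt0).
    by apply: le_lt_trans a2; rewrite mulrCA.
  have aM : (a <= (32 * A + 18) * m)%N.
    by rewrite -(ler_nat R) -(ler_pM2l h_gt0); exact: le_trans X1.
  have LE : L = ((32 * A + 18) * m + 14 * m)%N.
    by rewrite /L -mulnDl -addnA mulnS addnC.
  split=> //; last by rewrite -(natr1 a) mulrDr mulr1 in a2.
    by rewrite -ltnS; apply: leq_ltn_trans ma; rewrite leq_pmull.
  rewrite LE; apply: (leq_ltn_trans (leq_add aM (leqnn m))).
  by rewrite ltn_add2l ltn_Pmull.
have [a [ma aL Xa Xa1]] := coord _ (normr_Re_le_cabs z).
have [b [mb bL Yb Yb1]] := coord _ (normr_Im_le_cabs z).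
have XE : complex.Re (z - c) = complex.Re z + A.+1%:R * e.
  by rewrite raddfB /= opprK.
have YE : complex.Im (z - c) = complex.Im z + A.+1%:R * e.
  by rewrite raddfB /= opprK.
pose bx (p : 'I_L * 'I_L) := (a - m < p.1 <= a - m + 2 * m)%N &&
  (b - m < p.2 <= b - m + 2 * m)%N.
have nat_le (i j : nat) : (i <= j)%N -> h * i%:R <= h * j%:R.
  by move=> ij; rewrite ler_wpM2l ?ler_nat// ltW.
have am : h * (a - m)%:R = h * a%:R - e / 16 by rewrite natrB// mulrBr hmE.
have bm : h * (b - m)%:R = h * b%:R - e / 16 by rewrite natrB// mulrBr hmE.
have bxS p : bx p -> p \in S.
  move=> /andP[/andP[i1 i2] /andP[j1 j2]]; rewrite inE; apply/asboolP; exists k => //.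
  have -> : nd p - k = - (z - nd p) - (k - z).
    by rewrite !opprB addrA subrK.
  apply: le_trans (cabsD _ _) _; rewrite !cabsN.
  suff : cabs (z - nd p) <= e / 8 by move: kz; lra.
  apply: le_trans (cabs_le_Re_Im _) _.
  rewrite Re_sub_node Im_sub_node XE YE.
  have e16 : e / 8 = e / 16 + e / 16 by field.
  rewrite e16; apply: lerD; rewrite ler_norml; apply/andP; split.
  - have : (p.1 <= a + m)%N by rewrite -subn_add_double.
    by move=> /nat_le; rewrite (natrD _ a m) mulrDr hmE; lra.
  - move: i1 => /nat_le; rewrite -natr1 mulrDr am.
    by move: Xa1; lra.
  - have : (p.2 <= b + m)%N by rewrite -subn_add_double.
    by move=> /nat_le; rewrite (natrD _ b m) mulrDr hmE; lra.
  - move: j1 => /nat_le; rewrite -natr1 mulrDr bm.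
    by move: Yb1; lra.
have out (i d : nat) (x : R) : (m <= d)%N -> h * d%:R <= x -> x < h * d%:R + h ->
    ~~ (d - m < i <= d - m + 2 * m)%N -> e / 16 <= `|x - h * i%:R|.
  move=> md xd xd1; rewrite negb_and -leqNgt -ltnNge => /orP[] /nat_le id_.
    rewrite natrB// mulrBr hmE in id_.
    by apply: le_trans (ler_norm _); lra.
  rewrite (subn_add_double md) -addSn natrD -(natr1 d) !mulrDr mulr1 hmE in id_.
  by rewrite distrC; apply: le_trans (ler_norm _); lra.
have far p : p \in [pred p | (p \in S) && ~~ bx p] -> e / 16 <= cabs (z - nd p).
  rewrite inE => /andP[_]; rewrite negb_and => /orP[] Hp.
    apply: le_trans (normr_Re_le_cabs _); rewrite Re_sub_node XE.
    exact: (out _ a).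
  apply: le_trans (normr_Im_le_cabs _); rewrite Im_sub_node YE.
  exact: (out _ b).
have [Hfar _] := far_prods far.
have U0 p : 0 < U z p.
  rewrite /U cabsX exprn_gt0// cabs_gt0 subr_eq0.
  by apply: z_node; apply: ltnW; exact: ltn_ord.
have Hbox : 7 / 5 * \prod_(p | bx p) U z p <= \prod_(p | bx p) V z p.
  rewrite -ler_pdivlMr ?prodr_gt0// -prodf_div.
  have nd0 i j : (i <= (a + m).+1)%N -> (j <= (b + m).+1)%N ->
      z != node c h i j.
    by move=> ia jb; apply: z_node;
      [exact: leq_trans ia _|exact: leq_trans jb _].
  have XI : h * a%:R <= complex.Re (z - c) < h * a.+1%:R.
    by rewrite XE Xa -(natr1 a) mulrDr mulr1 Xa1.
  have YI : h * b%:R <= complex.Im (z - c) < h * b.+1%:R.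
    by rewrite YE Yb -(natr1 b) mulrDr mulr1 Yb1.
  have := box_prod_sqr_ge2 h_gt0 m_gt0 ma mb XI YI nd0.
  have l1 : (a - m + 2 * m < L)%N by rewrite subn_add_double.
  have l2 : (b - m + 2 * m < L)%N by rewrite subn_add_double.
  rewrite -(prod_box_ord (fun i j => cabs ((z - node c h i j) ^+ 4 - (h ^+ 4)%:C)
     / cabs ((z - node c h i j) ^+ 4)) l1 l2) => H2.
  rewrite -ler_sqr ?nnegrE; first by apply: le_trans H2; lra.
  - by lra.
  - by apply: prodr_ge0 => p _; rewrite divr_ge0// cabs_ge0.
rewrite (bigID bx) [leRHS](bigID bx) /=.
have bxE F : \prod_(p in S | bx p) F p = \prod_(p | bx p) F p :> R.
  by apply: eq_bigl => p; apply/andP/idP => [[]//|pb]; split=> //; exact: bxS.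
rewrite !bxE.
have -> : 21 / 16 * (\prod_(p | bx p) U z p * \prod_(p in S | ~~ bx p) U z p) =
    (7 / 5 * \prod_(p | bx p) U z p) *
    (15 / 16 * \prod_(p in S | ~~ bx p) U z p) by field.
apply: ler_pM => //; apply: mulr_ge0; rewrite ?divr_ge0//.
- by apply: prodr_ge0 => p _; exact: cabs_ge0.
- by apply: prodr_ge0 => p _; exact: cabs_ge0.
Qed.

(* [quartic] and [shifted] are the two polynomials in a factor of the quotient. *)
Let quartic (a : R[i]) : {poly R[i]} := ('X - a%:P) ^+ 4.
Let shifted (a : R[i]) : {poly R[i]} := quartic a - ((h ^+ 4)%:C)%:P.

Let quartic_monic a : quartic a \is monic.
Proof. by rewrite monic_exp// monicXsubC. Qed.

Let size_const_lt a : (size (- ((h ^+ 4)%:C)%:P : {poly R[i]})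
  < size (quartic a))%N.
Proof. by rewrite size_polyN size_exp_XsubC (leq_ltn_trans (size_polyC_leq1 _)). Qed.

Let shifted_monic a : shifted a \is monic.
Proof. by rewrite monicE lead_coefDl// -monicE quartic_monic. Qed.

(** The roots of [D] are the lattice points, where numerator and denominator may
vanish together and the quotient of their values says nothing. *)
Lemma exists_separating_polys : exists u v D : {poly R[i]},
  [/\ [/\ u \is monic, v \is monic, size u = size v & D != 0],
    forall z : R[i], (forall k, K k -> e / 2 <= cabs (z - k)) ->
      15 / 16 * cabs v.[z] <= cabs u.[z] /\ 0 < cabs u.[z]
  & forall z k : R[i], K k -> cabs (k - z) < e / 8 -> ~~ root D z ->
      21 / 16 * cabs u.[z] <= cabs v.[z]].
Proof.
exists (\prod_(p in S) quartic (nd p)), (\prod_(p in S) shifted (nd p)).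
exists (\prod_(p : 'I_L.+1 * 'I_L.+1) ('X - (node c h p.1 p.2)%:P)).
have uE z : cabs (\prod_(p in S) quartic (nd p)).[z] = \prod_(p in S) U z p.
  by rewrite horner_prod cabs_prod; apply: eq_bigr => p _; rewrite !hornerE.
have vE z : cabs (\prod_(p in S) shifted (nd p)).[z] = \prod_(p in S) V z p.
  by rewrite horner_prod cabs_prod; apply: eq_bigr => p _; rewrite !hornerE.
split.
- split; [exact: monic_prod|exact: monic_prod| |].
    rewrite !size_prod; try by move=> p _; rewrite monic_neq0.
    by congr (_.+1 - _)%N; apply: eq_bigr => p _; rewrite size_polyDl.
  by apply/prodf_neq0 => p _; rewrite polyXsubC_eq0.
- by move=> z zK; rewrite uE vE; exact: lattice_ratio_far.
- move=> z k Kk kz Dz; rewrite uE vE; apply: lattice_ratio_near Kk kz _.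
  move=> i j iL jL; apply: contraNneq Dz => zij.
  rewrite /root horner_prod; apply/prodf_eq0.
  rewrite -ltnS in iL; rewrite -ltnS in jL.
  by exists (Ordinal iL, Ordinal jL) => //=; rewrite hornerXsubC subr_eq0 zij.
Qed.

End LatticeRatio.

(** * Separation of K from Gamma *)

Section Distances.
Variable R : realType.
Implicit Types (K : set R[i]^o) (e : R).

Lemma dist_to_le K (z k : R[i]^o) : K k -> (dist_to K z <= (cabs (z - k))%:E)%E.
Proof. by move=> Kk; apply: ereal_inf_lbound; exists k. Qed.

Lemma dist_to_lt K (z : R[i]^o) (d : R) : (dist_to K z < d%:E)%E ->
  exists2 k, K k & cabs (z - k) < d.
Proof. by move=> /ereal_inf_lt[_ [k Kk <-]]; rewrite lte_fin; exists k. Qed.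

(** A point nearer to [K] than [e / 2] has a whole disc inside the thickening of
radius [e / 2], so it is interior to it. *)
Lemma Gamma_far K e (z : R[i]^o) : Gamma K e z ->
  forall k, K k -> e / 2 <= cabs (z - k).
Proof.
move=> [_ zint] k Kk; rewrite leNgt; apply/negP => zk; apply: zint.
apply/nbhs_cabsP; exists (e / 2 - cabs (z - k)); first by rewrite subr_gt0.
move=> w zw; rewrite /closed_thickening /=.
apply: le_trans (dist_to_le w Kk) _; rewrite lee_fin.
apply: le_trans (cabs_triangle z w k) _; rewrite cabs_distC.
by move: zw; lra.
Qed.

(** The bound [2 * e] instead of [e] avoids the question whether the infimum
defining the distance is attained. *)
Lemma Gamma_near K e (z : R[i]^o) : 0 < e -> Gamma K e z ->
  exists2 k, K k & cabs (z - k) < 2 * e.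
Proof.
move=> e0 [ze _]; apply: dist_to_lt; apply: le_lt_trans ze _.
by rewrite lte_fin; move: e0; lra.
Qed.

End Distances.

Theorem theorem2p1 (R : realType) (K : set R[i]^o) (e : R)
  (cptK : compact K) (e_gt0 : 0 < e) :
  exists r : ratfun R,
    [/\ compactly_inside K (lemniscate r),
        lemniscate r `&` Gamma K e = set0
      & (size (rden r) < size (rnum r))%N].
Proof.
have [B KB] := compact_cabs_bounded cptK.
pose A := (Num.truncn (B / e)).+1.
have KA k : K k -> cabs k <= A%:R * e.
  move=> Kk; rewrite -ler_pdivrMr//; apply: le_trans (ltW (truncnS_gt _)).
  by rewrite ler_pM2r ?invr_gt0// KB.
have [u [v [D [[mu mv suv D0] far near]]]] := exists_separating_polys e_gt0 KA.
(* [M] bounds the modulus on the [2 * e]-neighbourhood of [K], so [eta * z]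
   contributes at most [1 / 50] there. *)
pose M := (A%:R + 2) * e.
have M0 : 0 < M by rewrite mulr_gt0// ltr_wpDl.
pose eta := (50 * M)^-1.
have eta0 : 0 < eta by rewrite invr_gt0 mulr_gt0.
pose p := (6 / 5)%:C *: u + eta%:C *: ('X * v).
have pE z : p.[z] = (6 / 5)%:C * u.[z] + eta%:C * z * v.[z].
  by rewrite /p hornerD !hornerZ hornerM hornerX mulrA.
have small (z k : R[i]) : K k -> cabs (z - k) < 2 * e ->
    cabs (eta%:C * z * v.[z]) <= 1 / 50 * cabs v.[z].
  move=> Kk zk; rewrite !cabsM ler_wpM2r ?cabs_ge0//.
  rewrite cabs_real gtr0_norm// /eta mulrC ler_pdivrMr ?mulr_gt0//.
  have -> : 1 / 50 * (50 * M) = M by field.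
  rewrite /M mulrDl; have := KA k Kk; have := cabs_dist_sub z k.
  by move: zk; lra.
have main z : cabs ((6 / 5)%:C * u.[z]) = 6 / 5 * cabs u.[z].
  by rewrite cabsM cabs_real ger0_norm.
have vp : (size v < size p)%N.
  have sX : size (eta%:C *: ('X * v)) = (size v).+1.
    have etaC0 : eta%:C != 0 by rewrite -cabs_gt0 cabs_real normr_gt0 gt_eqF.
    by rewrite (size_scale _ etaC0) (mulrC 'X v) size_mulX// monic_neq0.
  rewrite /p addrC size_polyDl sX // ltnS -suv; exact: size_scale_leq.
have [r [size_r far_r near_r]] := exists_ratfun (monic_neq0 mv) vp.
exists r; split => //.
- move=> z Kz; apply/nbhs_cabsP; exists (e / 16); first by rewrite divr_gt0.
  move=> w zw; apply: (near_r D w (e / 16)) => //; first by rewrite divr_gt0.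
  move=> x wx Dx.
  have zx : cabs (z - x) < e / 8.
    by have := cabs_triangle w z x; move: zw wx; lra.
  (* [6 / 5 * 16 / 21 + 1 / 50 < 1]. *)
  have := near x z Kz zx Dx.
  have xz : cabs (x - z) < 2 * e by rewrite cabs_distC; move: zx e_gt0; lra.
  have := small x z Kz xz; have := main x.
  rewrite pE; have := cabsD ((6 / 5)%:C * u.[x]) (eta%:C * x * v.[x]).
  have := cabs_ge0 v.[x]; have := cabs_ge0 u.[x].
  lra.
- apply/seteqP; split => // z [zr zG]; apply: (far_r z) zr.
  have [uv u0] := far z (Gamma_far zG).
  have [k Kk zk] := Gamma_near e_gt0 zG.
  (* [6 / 5 * |u| - 1 / 50 * |v| > |v|] because [|v| <= 16 / 15 * |u|] and
     [51 / 50 * 16 / 15 < 6 / 5]. *)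
  have := small z k Kk zk; have := main z.
  have := cabs_dist_sub ((6 / 5)%:C * u.[z]) (- (eta%:C * z * v.[z])).
  rewrite opprK -pE cabsN.
  have := cabs_ge0 v.[z]; move: uv u0.
  lra.
Qed.
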